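(* Every stable metric space is $1$-upper stable.
   Context: A metric space $(X,d_X)$ is stable if for any two bounded sequences $(x_n)_{n\ge1}$, $(y_n)_{n\ge1}$ in $X$ and any two non-principal ultrafilters $\mathcal{U},\mathcal{V}$ on $\mathbb{N}$, $\lim_{m\to\mathcal{U}}\lim_{n\to\mathcal{V}}d_X(x_m,y_n)=\lim_{n\to\mathcal{V}}\lim_{m\to\mathcal{U}}d_X(x_m,y_n)$. For a set $M\subseteq\mathbb{N}$ and $k\ge0$, $[M]^k$ is the set of $k$-element subsets of $M$, written as increasing tuples $\bar n=(n_1,\dots,n_k)$, $n_1<\dots<n_k$; $[k]=\{1,\dots,k\}$. A metric space $(X,d_X)$ is $K_u$-upper stable ($K_u>0$) if for every $k\ge1$, every $1\le\ell\le k$, every permutation $\pi\colon[k]\to[k]$ which preserves the order on $\{1,\dots,\ell\}$ and on $\{\ell+1,\dots,k\}$, all bounded maps $f\colon[\mathbb{N}]^\ell\to X$ and $g\colon[\mathbb{N}]^{k-\ell}\to X$, and every infinite $M\subseteq\mathbb{N}$, $$\inf_{\bar n\in[M]^k}d_X\big(f(n_1,\dots,n_\ell),g(n_{\ell+1},\dots,n_k)\big)\le K_u\sup_{\bar n\in[M]^k}d_X\big(f(n_{\pi(1)},\dots,n_{\pi(\ell)}),g(n_{\pi(\ell+1)},\dots,n_{\pi(k)})\big).$$ *)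

(* Defs.v *)
From HB Require Import structures.
From mathcomp Require Import all_boot all_order all_algebra perm.
From mathcomp Require Import all_classical all_reals all_analysis.
Set Implicit Arguments.
Unset Strict Implicit.
Unset Printing Implicit Defensive.
Import Order.TTheory GRing.Theory Num.Theory.
Import numFieldNormedType.Exports.
Local Open Scope classical_set_scope.
Local Open Scope ring_scope.

Definition bounded_map (R : realType) (X : metricType R) (T : Type)
    (f : T -> X) : Prop :=
  exists r : R, forall s t : T, mdist (f s) (f t) <= r.

Definition nonprincipal (U : set_system nat) : Prop :=
  forall n : nat, U <> principal_filter n.

(* [lim] is total, but every limit below is that of a bounded real sequence
   along an ultrafilter, hence a genuine limit by compactness. *)
Definition stable_metric (R : realType) (X : metricType R) : Prop :=
  forall x y : nat -> X, bounded_map x -> bounded_map y ->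
  forall U V : set_system nat,
    UltraFilter U -> nonprincipal U -> UltraFilter V -> nonprincipal V ->
    lim ((fun m => lim ((fun n => mdist (x m) (y n) : R) @ V)) @ U) =
    lim ((fun n => lim ((fun m => mdist (x m) (y n) : R) @ U)) @ V).

(* The k-element subsets of nat, as increasing k-tuples. *)
Record incr_tuple (k : nat) := IncrTuple {
  incr_tval :> k.-tuple nat;
  incr_tvalP : sorted ltn incr_tval }.

Definition incr_tuples_in (k : nat) (M : set nat) : set (incr_tuple k) :=
  [set n | forall i : 'I_k, M (tnth n i)].

Definition incr_ord (l k : nat) (s : 'I_l -> 'I_k) : Prop :=
  forall i j : 'I_l, (i < j)%N -> (s i < s j)%N.

Lemma incr_lshift (l m : nat) : incr_ord (@lshift l m).
Proof. by []. Qed.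

Lemma incr_rshift (l m : nat) : incr_ord (@rshift l m).
Proof. by move=> i j ij /=; rewrite ltn_add2l. Qed.

Lemma sub_incr_sorted (l k : nat) (s : 'I_l -> 'I_k) (n : incr_tuple k) :
  incr_ord s -> sorted ltn [tuple tnth n (s i) | i < l].
Proof.
move=> hs; apply/(sortedP 0%N) => i; rewrite size_tuple => il.
rewrite /= (_ : nth _ _ i = tnth n (s (Ordinal (ltnW il)))); last first.
  by rewrite -(tnth_mktuple (fun j => tnth n (s j))) (tnth_nth 0%N).
rewrite (_ : nth _ _ i.+1 = tnth n (s (Ordinal il))); last first.
  by rewrite -(tnth_mktuple (fun j => tnth n (s j))) (tnth_nth 0%N).
rewrite !(tnth_nth 0%N).
by apply: (sorted_ltn_nth ltn_trans 0%N (incr_tvalP n));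
  rewrite ?inE ?size_tuple //; exact: hs.
Qed.

(* (n_{s(1)}, ..., n_{s(l)}), again an increasing tuple when s is increasing *)
Definition sub_incr (l k : nat) (s : 'I_l -> 'I_k) (hs : incr_ord s)
    (n : incr_tuple k) : incr_tuple l :=
  IncrTuple (sub_incr_sorted n hs).

(* Here k = l + m with l >= 1 and m >= 0, so that m is k - l; the indices
   1..l and l+1..k are the images of [lshift] and [rshift]. The hypotheses
   [p1] and [p2] say that p preserves the order on each of these blocks.
   [inf] and [sup] are those of nonempty bounded sets of reals. *)
Definition upper_stable (R : realType) (K : R) (X : metricType R) : Prop :=
  0 < K /\
  forall (l m : nat), (0 < l)%N ->
  forall (p : 'S_(l + m))
    (p1 : incr_ord (fun i : 'I_l => p (lshift m i)))
    (p2 : incr_ord (fun i : 'I_m => p (rshift l i)))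
    (f : incr_tuple l -> X) (g : incr_tuple m -> X),
    bounded_map f -> bounded_map g ->
  forall M : set nat, infinite_set M ->
    inf [set mdist (f (sub_incr (@incr_lshift l m) n))
                   (g (sub_incr (@incr_rshift l m) n))
        | n in @incr_tuples_in (l + m) M]
    <= K * sup [set mdist (f (sub_incr p1 n)) (g (sub_incr p2 n))
               | n in @incr_tuples_in (l + m) M].

(* Main.v *)
Require Import Defs.
From mathcomp Require Import all_boot all_order all_algebra perm.
From mathcomp Require Import all_classical all_reals all_analysis.
Local Open Scope ring_scope.
Import Order.TTheory GRing.Theory Num.Theory.
Import numFieldNormedType.Exports.
Local Open Scope classical_set_scope.
Set Implicit Arguments.
Unset Strict Implicit.

(** Fix a nonprincipal ultrafilter U on nat that contains the infinite set M.
    A word w with l letters [true] and m letters [false] prescribes an order in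
    which to take l + m successive limits along U of d(f(a), g(b)): a letter
    [true] binds the next entry of the tuple a, a letter [false] the next entry
    of b. A permutation p that is increasing on both blocks amounts to such a
    word, and the iterated limit in the order of p is at most the supremum over
    the increasing tuples in M; likewise the iterated limit for the identity,
    whose word is l letters [true] followed by m letters [false], is at least
    the infimum. So it suffices that the iterated limit depends only on the
    numbers of letters of each kind, not on their order ([iter_lim_shuffle]).

    Stability gives the exchange of the two full blocks: l limits along U are
    one limit along the l-th tensor power of U, an ultrafilter on finite
    sequences, which is transported to nat by an enumeration of the finite
    sequences ([iter_lim_block_swap]). All other words follow by induction on
    the word. Fixing the first variable leaves a shorter word for the functions
    with that variable frozen, and by induction this shorter word may be
    rearranged at will. Hence every word starting with [true] has the limit of
    (true^l false^m), every word starting with [false] has that of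
    (false^m true^l), and these two agree by the block exchange. *)

(** * Ultrafilters on the natural numbers *)

Lemma ultrafilter_dichotomy (T : Type) (F : set_system T) :
  ProperFilter F -> (forall A, F A \/ F (~` A)) -> UltraFilter F.
Proof.
move=> PF FC; split=> // G PG FG; rewrite eqEsubset; split=> // A GA.
have [//|/FG GnA] := FC A.
by have := filter_not_empty G; rewrite -(setICr A); case; exact: filterI.
Qed.

Lemma ultrafilter_fmap (S T : Type) (h : S -> T) (U : set_system S) :
  UltraFilter U -> UltraFilter (h @ U).
Proof.
move=> UU; apply: ultrafilter_dichotomy => A.
exact: (in_ultra_setVsetC (h @^-1` A)).
Qed.

Lemma nonprincipalP (U : set_system nat) : UltraFilter U ->
  nonprincipal U <-> (forall n, ~ U [set n]).
Proof.
move=> UU; split=> [nU n Un|nU n Un]; last first.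
  by apply: (nU n); rewrite Un; exact/principal_filterP.
apply: (nU n); rewrite eqEsubset; split=> A.
  move=> UA; apply/principal_filterP.
  by have [_ [-> //]] := filter_ex (filterI Un UA).
by move/principal_filterP => An; apply: filterS Un => _ ->.
Qed.

Lemma infinite_nat_gt (M : set nat) (k : nat) :
  infinite_set M -> exists2 n, M n & (k < n)%N.
Proof.
move=> Minf; apply: contrapT => nM; apply: Minf.
apply: (sub_finite_set _ (finite_II k.+1)) => n Mn /=.
by rewrite ltnS leqNgt; apply/negP => kn; apply: nM; exists n.
Qed.

Lemma ultrafilter_of_infinite_set (M : set nat) : infinite_set M ->
  exists U : set_system nat, [/\ UltraFilter U, nonprincipal U
    & forall k, U [set n | M n /\ (k < n)%N]].
Proof.
move=> Minf.
pose F := filter_from setT (fun k : nat => [set n | M n /\ (k < n)%N]).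
have PF : ProperFilter F.
  apply: filter_from_proper.
    apply: filter_from_filter => [|i j _ _]; first by exists 0%N.
    exists (maxn i j) => // n [Mn]; rewrite gtn_max => /andP[? ?].
    by split.
  by move=> k _; have [n Mn kn] := infinite_nat_gt k Minf; exists n.
have [U [UU FU]] := ultraFilterLemma PF.
have UM k : U [set n | M n /\ (k < n)%N] by apply: FU; exists k.
exists U; split=> //; apply/nonprincipalP => n Un.
have [m [-> [_]]] := filter_ex (filterI Un (UM n)).
by rewrite ltnn.
Qed.

(** * Limits of bounded real functions along ultrafilters *)

Section UltraLimits.
Variable R : realType.

Lemma ultralimit_cvg (T : Type) (U : set_system T) (h : T -> R) (B : R) :
  UltraFilter U -> (forall t, `|h t| <= B) -> h @ U --> lim (h @ U).
Proof.
move=> UU hB; have hU := ultrafilter_fmap h UU.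
have := segment_compact (a := - B) (b := B).
rewrite compact_ultra => /(_ (h @ U) hU) [|l [_ hl]]; last exact: cvgP hl.
suff : U [set t | `[- B, B] (h t)] by [].
by apply: filterE => t; rewrite /= in_itv /= -ler_norml.
Qed.

Lemma lim_principal_filter (T : Type) (h : T -> R) (x : T) :
  lim (h @ principal_filter x) = h x.
Proof.
have PF := principal_filter_proper x.
apply/cvg_lim => //; move=> A /nbhs_singleton Ahx.
exact/principal_filterP.
Qed.

Lemma ultralimit_closed (T : Type) (U : set_system T) (h : T -> R) (B : R)
    (C : set R) : UltraFilter U -> (forall t, `|h t| <= B) -> closed C ->
  U [set t | C (h t)] -> C (lim (h @ U)).
Proof.
move=> UU hB clC UC; exact: closed_cvg clC UC _ (ultralimit_cvg UU hB).
Qed.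

Lemma ultralimit_norm_le (T : Type) (U : set_system T) (h : T -> R) (B : R) :
  UltraFilter U -> (forall t, `|h t| <= B) -> `|lim (h @ U)| <= B.
Proof.
move=> UU hB; rewrite ler_norml.
have := ultralimit_closed (C := `[- B, B]) UU hB (@itv_closed _ _ (- B) B).
rewrite /= in_itv /=; apply.
by apply: filterE => t; rewrite /= in_itv /= -ler_norml.
Qed.

End UltraLimits.

(** * Tensor powers of an ultrafilter *)

Section TensorPower.
Variables (U : set_system nat).

(** The l-th tensor power of U: A is large when for U-almost all n_1, ..., for
    U-almost all n_l, the sequence (n_1, ..., n_l) is in A. It lives on all
    finite sequences and concentrates on those of size l. *)
Fixpoint tensor_power (l : nat) : set_system (seq nat) :=
  if l is l'.+1 then [set A | U [set n | tensor_power l' [set s | A (n :: s)]]]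
  else principal_filter [::].

Lemma tensor_power_ultra (l : nat) :
  UltraFilter U -> UltraFilter (tensor_power l).
Proof.
move=> UU; elim: l => [|l IH] /=; first exact: principal_filter_ultra.
pose F := [set A | U [set n | tensor_power l [set s | A (n :: s)]]].
have FF : Filter F.
  rewrite /F; split=> [|A B /= UA UB|A B AB /= UA] /=.
  - by apply: filterE => n; exact: filterT.
  - by apply: filterS (filterI UA UB) => n [nA nB]; exact: filterI.
  - by apply: filterS UA => n; apply: filterS => s; exact: AB.
have PF : ProperFilter F.
  apply: Build_ProperFilter_ex.
  move=> A; rewrite /F /= => /filter_ex [n /filter_ex [s As]].
  by exists (n :: s).
apply: ultrafilter_dichotomy => A /=.
have [UA|UA] := in_ultra_setVsetC
  [set n | tensor_power l [set s | A (n :: s)]] UU; [by left|right].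
apply: filterS UA => n /= nA.
by have [//|] := in_ultra_setVsetC [set s | A (n :: s)] IH.
Qed.

Lemma tensor_power_set1 (l : nat) (s : seq nat) :
  UltraFilter U -> nonprincipal U -> ~ tensor_power l.+1 [set s].
Proof.
move=> UU /nonprincipalP nU /= Us.
have Ul := tensor_power_ultra l UU.
apply: (nU (head 0%N s)); apply: filterS Us => n /= /filter_ex [t /= <- //].
Qed.

Variable R : realType.

Lemma ultralimit_tensor_powerS (l : nat) (h : seq nat -> R) (B : R) :
  UltraFilter U -> (forall s, `|h s| <= B) ->
  lim (h @ tensor_power l.+1) =
  lim ((fun n => lim ((fun s => h (n :: s)) @ tensor_power l)) @ U).
Proof.
move=> UU hB; have Ul := tensor_power_ultra l UU.
have UlS : UltraFilter (tensor_power l.+1) := tensor_power_ultra l.+1 UU.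
set c := lim (h @ _).
have hc : h @ tensor_power l.+1 --> c := ultralimit_cvg UlS hB.
apply/esym/cvg_lim => //; apply/cvgrPdist_le => /= e e0.
have hcU : U [set n | tensor_power l [set s | `|c - h (n :: s)| <= e]].
  by move/cvgrPdist_le : hc; exact.
apply: filterS hcU => n /= hn.
pose C := [set x : R | `|c - x| <= e].
have clC : closed C.
  have -> : C = `[c - e, c + e].
    by apply/seteqP; split=> x; rewrite /C /= in_itv /= distrC ler_distl //.
  exact: itv_closed.
exact: (ultralimit_closed (C := C) Ul (fun s => hB (n :: s)) clC hn).
Qed.

End TensorPower.

(** * Iterated limits prescribed by a word *)

Section IteratedLimit.
Variables (R : realType) (U : set_system nat).

(** The iterated limit of F along U, outermost limit first: the variable bound
    by a letter [true] is the next entry of the first argument of F, the one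
    bound by a letter [false] the next entry of the second. *)
Fixpoint iter_lim (w : seq bool) (F : seq nat -> seq nat -> R) : R :=
  match w with
  | [::] => F [::] [::]
  | true :: w' => lim ((fun n => iter_lim w' (fun a b => F (n :: a) b)) @ U)
  | false :: w' => lim ((fun n => iter_lim w' (fun a b => F a (n :: b))) @ U)
  end.

Hypothesis UU : UltraFilter U.

Lemma iter_lim_norm_le (w : seq bool) (F : seq nat -> seq nat -> R) (B : R) :
  (forall a b, `|F a b| <= B) -> `|iter_lim w F| <= B.
Proof.
by elim: w F => [|[] w IH] F FB /=;
  [exact: FB|apply: ultralimit_norm_le => n; exact: IH..].
Qed.

(** For an increasing sequence s of the size of w, the letters of w distribute
    the entries of s over the two arguments of F. If the resulting values of F
    stay in a closed set as s ranges over the increasing sequences in M, so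
    does the iterated limit. *)
Lemma iter_lim_closed (M : set nat) (w : seq bool)
    (F : seq nat -> seq nat -> R) (B : R) (C : set R) :
  (forall k, U [set n | M n /\ (k < n)%N]) ->
  (forall a b, `|F a b| <= B) -> closed C ->
  (forall s : seq nat, size s = size w -> sorted ltn s ->
    (forall x, x \in s -> M x) -> C (F (mask w s) (mask (map negb w) s))) ->
  C (iter_lim w F).
Proof.
move=> UM FB clC FC.
(* The induction is on sequences with all entries above a bound k, initially
   0: at each step U-almost all n lie in M above the previous entry. *)
have {FC} : forall s : seq nat, size s = size w -> path ltn 0%N s ->
    (forall x, x \in s -> M x) -> C (F (mask w s) (mask (map negb w) s)).
  by move=> s sw /path_sorted; exact: FC.
elim: w 0%N F FB => [|c w IH] k F FB FC /=; first by apply: (FC [::]).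
have cons_ok n s : M n -> (k < n)%N -> size s = size w -> path ltn n s ->
    (forall x, x \in s -> M x) ->
    C (F (mask (c :: w) (n :: s)) (mask (map negb (c :: w)) (n :: s))).
  move=> Mn kn sw ps sM; apply: FC => /=; rewrite ?sw ?kn//.
  by move=> x; rewrite inE => /predU1P[->|/sM].
by case: c FC cons_ok => /= _ cons_ok;
  apply: (ultralimit_closed (B := B)) => // [n|];
  [exact: iter_lim_norm_le| |exact: iter_lim_norm_le|];
  apply: filterS (UM k) => n [Mn kn]; apply: (IH n) => // s sw ps sM;
  exact: cons_ok.
Qed.

Lemma iter_lim_nseq_true (l : nat) (w : seq bool)
    (F : seq nat -> seq nat -> R) (B : R) : (forall a b, `|F a b| <= B) ->
  iter_lim (nseq l true ++ w) F =
  lim ((fun s => iter_lim w (fun a b => F (s ++ a) b)) @ tensor_power U l).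
Proof.
elim: l F => [|l IH] F FB.
  by rewrite /= lim_principal_filter.
rewrite (@ultralimit_tensor_powerS _ _ _ _ B) => //; last first.
  by move=> s; exact: iter_lim_norm_le.
by rewrite /=; congr (lim (_ @ U)); apply/funext => n; rewrite IH.
Qed.

Lemma iter_lim_nseq_false (l : nat) (w : seq bool)
    (F : seq nat -> seq nat -> R) (B : R) : (forall a b, `|F a b| <= B) ->
  iter_lim (nseq l false ++ w) F =
  lim ((fun s => iter_lim w (fun a b => F a (s ++ b))) @ tensor_power U l).
Proof.
elim: l F => [|l IH] F FB.
  by rewrite /= lim_principal_filter.
rewrite (@ultralimit_tensor_powerS _ _ _ _ B) => //; last first.
  by move=> s; exact: iter_lim_norm_le.
by rewrite /=; congr (lim (_ @ U)); apply/funext => n; rewrite IH.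
Qed.

End IteratedLimit.

(** * Independence of the order of the limits *)

Lemma bounded_map_comp (R : realType) (X : metricType R) (S T : Type)
    (f : T -> X) (h : S -> T) : bounded_map f -> bounded_map (f \o h).
Proof. by case=> r fr; exists r => s t; exact: fr. Qed.

Lemma bounded_mdist (R : realType) (X : metricType R) (S T : Type)
    (f : S -> X) (g : T -> X) : bounded_map f -> bounded_map g ->
  exists B : R, forall s t, `|mdist (f s) (g t)| <= B.
Proof.
move=> [rf fr] [rg gr].
have [[s0 _]|nS] := pselect (exists s : S, True); last first.
  by exists 0 => s; case: nS; exists s.
have [[t0 _]|nT] := pselect (exists t : T, True); last first.
  by exists 0 => s t; case: nT; exists t.
exists (rf + (mdist (f s0) (g t0) + rg)) => s t; rewrite ger0_norm ?mdist_ge0//.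
apply: (le_trans (metric_triangle _ (f s0) _)); apply: lerD => //.
by apply: (le_trans (metric_triangle _ (g t0) _)); rewrite lerD2l.
Qed.

Section Shuffle.
Variables (R : realType) (X : metricType R) (U : set_system nat).
Hypotheses (stX : stable_metric X) (UU : UltraFilter U) (nU : nonprincipal U).

(** Stability, stated for sequences indexed by nat, extends to families indexed
    by finite sequences because these are countable. *)
Lemma stable_tensor_power (l m : nat) (f g : seq nat -> X) :
  bounded_map f -> bounded_map g ->
  lim ((fun s => lim ((fun t => mdist (f s) (g t) : R)
    @ tensor_power U m.+1)) @ tensor_power U l.+1) =
  lim ((fun t => lim ((fun s => mdist (f s) (g t) : R)
    @ tensor_power U l.+1)) @ tensor_power U m.+1).
Proof.
move=> bf bg.
pose dec (n : nat) : seq nat := odflt [::] (unpickle n).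
have decK s : dec (pickle s) = s by rewrite /dec pickleK.
have ultra k : UltraFilter (pickle @ tensor_power U k.+1).
  exact/ultrafilter_fmap/tensor_power_ultra.
have free k : nonprincipal (pickle @ tensor_power U k.+1).
  apply/nonprincipalP => n Un; apply: (@tensor_power_set1 U k (dec n)) => //.
  have Uk := tensor_power_ultra k.+1 UU.
  have {}Un : tensor_power U k.+1 [set s | pickle s = n] := Un.
  by apply: filterS Un => s /= <-; rewrite decK.
have decE (h : seq nat -> X) : h \o dec \o pickle = h.
  by apply/funext => s /=; rewrite decK.
have : lim ((fun s => lim ((fun t =>
      mdist ((f \o dec \o pickle) s) ((g \o dec \o pickle) t) : R)
    @ tensor_power U m.+1)) @ tensor_power U l.+1) =
  lim ((fun t => lim ((fun s =>
      mdist ((f \o dec \o pickle) s) ((g \o dec \o pickle) t) : R)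
    @ tensor_power U l.+1)) @ tensor_power U m.+1).
  exact: (stX (bounded_map_comp dec bf) (bounded_map_comp dec bg)
    (ultra l) (free l) (ultra m) (free m)).
by rewrite !decE.
Qed.

Lemma iter_lim_block_swap (l m : nat) (f g : seq nat -> X) :
  bounded_map f -> bounded_map g ->
  iter_lim U (nseq l true ++ nseq m false) (fun a b => mdist (f a) (g b)) =
  iter_lim U (nseq m false ++ nseq l true) (fun a b => mdist (f a) (g b)).
Proof.
move=> bf bg; have [B FB] := bounded_mdist bf bg.
case: l m => [|l] [|m]; rewrite ?cats0//.
rewrite (iter_lim_nseq_true UU l.+1 _ FB) (iter_lim_nseq_false UU m.+1 _ FB).
have -> : (fun s => iter_lim U (nseq m.+1 false)
    (fun a b => mdist (f (s ++ a)) (g b))) =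
    fun s => lim ((fun t => mdist (f s) (g t)) @ tensor_power U m.+1).
  apply/funext => s; rewrite -[nseq _ _]cats0.
  rewrite (iter_lim_nseq_false UU m.+1 _ (fun a => FB (s ++ a))) /=.
  by congr (lim (_ @ tensor_power U m.+1)); apply/funext => t; rewrite !cats0.
have -> : (fun s => iter_lim U (nseq l.+1 true)
    (fun a b => mdist (f a) (g (s ++ b)))) =
    fun t => lim ((fun s => mdist (f s) (g t)) @ tensor_power U l.+1).
  apply/funext => t; rewrite -[nseq _ _]cats0.
  rewrite (iter_lim_nseq_true UU l.+1 _ (fun a b => FB a (t ++ b))) /=.
  by congr (lim (_ @ tensor_power U l.+1)); apply/funext => s; rewrite !cats0.
exact: stable_tensor_power.
Qed.

Lemma iter_lim_shuffle (w : seq bool) (f g : seq nat -> X) :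
  bounded_map f -> bounded_map g ->
  iter_lim U w (fun a b => mdist (f a) (g b)) =
  iter_lim U (nseq (count id w) true ++ nseq (count negb w) false)
    (fun a b => mdist (f a) (g b)).
Proof.
elim: w f g => [//|[] w IH] f g bf bg.
  rewrite /=; congr (lim (_ @ U)); apply/funext => n; apply: IH => //.
  exact: (bounded_map_comp (cons n)).
(* A leading [false] is reached from the canonical word by exchanging its
   blocks; once that variable is fixed, the blocks are exchanged back. *)
rewrite [RHS]iter_lim_block_swap//=.
congr (lim (_ @ U)); apply/funext => n.
have bgn : bounded_map (fun b => g (n :: b)) by exact: bounded_map_comp bg.
by rewrite IH// iter_lim_block_swap.
Qed.

End Shuffle.

(** * Increasing tuples and block-increasing permutations *)

Lemma incr_tval_inj (k : nat) (s t : incr_tuple k) :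
  s = t :> seq nat -> s = t.
Proof.
case: s t => [s sP] [t tP] /= /val_inj st; rewrite st in sP *.
by congr IncrTuple; exact: bool_irrelevance.
Qed.

Lemma incr_tuple_of_seq (k : nat) (s : seq nat) :
  size s = k -> sorted ltn s -> {t : incr_tuple k | t = s :> seq nat}.
Proof.
by move=> /eqP sk ss; exists (@IncrTuple k (Tuple sk) ss).
Qed.

(** Precomposition with this retraction extends maps on increasing tuples to all
    finite sequences, without enlarging their range. *)
Lemma incr_tuple_retraction (k : nat) :
  exists r : seq nat -> incr_tuple k, forall t : incr_tuple k, r t = t.
Proof.
have [t0 _] := incr_tuple_of_seq (size_iota 0 k) (iota_ltn_sorted 0 k).
have /choice [r rP] (s : seq nat) : exists t : incr_tuple k,
    (exists t' : incr_tuple k, t' = s :> seq nat) -> t = s :> seq nat.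
  have [[t ts]|nt] := pselect (exists t : incr_tuple k, t = s :> seq nat).
    by exists t.
  by exists t0.
by exists r => t; apply: incr_tval_inj; apply: rP; exists t.
Qed.

(** An increasing selection of entries is determined by the set of selected
    positions. *)
Lemma sub_incr_mask (l k : nat) (s : 'I_l -> 'I_k) (hs : incr_ord s)
    (P : pred 'I_k) (n : incr_tuple k) :
  (forall j, reflect (exists i, s i = j) (P j)) ->
  sub_incr hs n = mask (map P (enum 'I_k)) n :> seq nat.
Proof.
move=> sP.
have nE : n = map (tnth n) (enum 'I_k) :> seq nat.
  by rewrite map_tnth_enum.
apply: (irr_sorted_eq ltn_trans ltnn).
- exact: (incr_tvalP (sub_incr hs n)).
- by apply: sorted_mask => //; [exact: ltn_trans|exact: incr_tvalP].
move=> x; rewrite [in RHS]nE -map_mask -filter_mask.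
apply/mapP/mapP => [[i _ ->]|[j]].
  exists (s i) => //; rewrite mem_filter mem_enum andbT.
  by apply/sP; exists i.
rewrite mem_filter => /andP[/sP[i <-] _ ->].
by exists i => //; rewrite mem_enum.
Qed.

Section BlockWord.
Variables l m : nat.
Implicit Types (q : 'S_(l + m)) (n : incr_tuple (l + m)).

(** The word of a permutation q: its j-th letter is [true] exactly when q sends
    an index of the first block to j. *)
Definition block_word q : seq bool :=
  [seq (q^-1%g j < l)%N | j <- enum 'I_(l + m)].

Lemma size_block_word q : size (block_word q) = (l + m)%N.
Proof. by rewrite size_map size_enum_ord. Qed.

Lemma lshift_blockP q j :
  reflect (exists i, q (lshift m i) = j) (q^-1%g j < l)%N.
Proof.
apply: (iffP idP) => [jl|[i <-]]; last by rewrite permK /=.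
by exists (Ordinal jl); rewrite -[RHS](permKV q); congr (q _); exact: val_inj.
Qed.

Lemma rshift_blockP q j :
  reflect (exists i, q (rshift l i) = j) (~~ (q^-1%g j < l)%N).
Proof.
apply: (iffP idP) => [|[i <-]]; last by rewrite permK /= -leqNgt leq_addr.
rewrite -leqNgt => jl; have jm : (q^-1%g j - l < m)%N by rewrite ltn_subLR.
exists (Ordinal jm); rewrite -[RHS](permKV q); congr (q _).
by apply: val_inj; rewrite /= subnKC.
Qed.

Lemma mask_block_word_l q (s : 'I_l -> 'I_(l + m)) (hs : incr_ord s) n :
  (forall i, s i = q (lshift m i)) ->
  mask (block_word q) n = sub_incr hs n :> seq nat.
Proof.
move=> sq; rewrite (@sub_incr_mask _ _ _ hs (fun j => (q^-1%g j < l)%N))// => j.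
by have := lshift_blockP q j; under eq_exists do rewrite -sq.
Qed.

Lemma mask_block_word_r q (s : 'I_m -> 'I_(l + m)) (hs : incr_ord s) n :
  (forall i, s i = q (rshift l i)) ->
  mask (map negb (block_word q)) n = sub_incr hs n :> seq nat.
Proof.
move=> sq; rewrite -map_comp.
rewrite (@sub_incr_mask _ _ _ hs (fun j => ~~ (q^-1%g j < l)%N))// => j.
by have := rshift_blockP q j; under eq_exists do rewrite -sq.
Qed.

Lemma count_block_word_l q : count id (block_word q) = l.
Proof.
rewrite count_map -sum1_count big_enum_cond /= (reindex_perm q) /=.
under eq_bigl do rewrite permK.
rewrite big_split_ord /= [X in (_ + X)%N]big1 => [|i]; last first.
  by rewrite /= ltnNge leq_addr.
by under eq_bigl do rewrite ltn_ord; rewrite sum1_card card_ord addn0.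
Qed.

Lemma count_block_word_r q : count negb (block_word q) = m.
Proof.
apply/eqP; rewrite -(eqn_add2l (count id (block_word q))).
by rewrite (count_predC id) size_block_word count_block_word_l.
Qed.

End BlockWord.

Theorem lemma6 (R : realType) (X : metricType R) :
  stable_metric X -> upper_stable (1 : R) X.
Proof.
move=> stX; split=> // l m l0 p p1 p2 f g bf bg M Minf.
have [U [UU nU UM]] := ultrafilter_of_infinite_set Minf.
have [rl rlK] := incr_tuple_retraction l.
have [rm rmK] := incr_tuple_retraction m.
have bf' : bounded_map (f \o rl) := bounded_map_comp rl bf.
have bg' : bounded_map (g \o rm) := bounded_map_comp rm bg.
have [B FB] := bounded_mdist bf' bg'.
have [B' fgB'] := bounded_mdist bf bg.
pose F (a b : seq nat) : R := mdist ((f \o rl) a) ((g \o rm) b).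
pose w1 := block_word (1%g : 'S_(l + m)).
have F1 (n : incr_tuple (l + m)) :
    F (mask w1 n) (mask (map negb w1) n) =
    mdist (f (sub_incr (@incr_lshift l m) n))
      (g (sub_incr (@incr_rshift l m) n)).
  rewrite /F /= (mask_block_word_l (@incr_lshift l m)); last first.
    by move=> i; rewrite perm1.
  rewrite (mask_block_word_r (@incr_rshift l m)) ?rlK ?rmK// => i.
  by rewrite perm1.
have Fp (n : incr_tuple (l + m)) :
    F (mask (block_word p) n) (mask (map negb (block_word p)) n) =
    mdist (f (sub_incr p1 n)) (g (sub_incr p2 n)).
  by rewrite /F /= (mask_block_word_l p1)// (mask_block_word_r p2)// rlK rmK.
have tupleM s : size s = (l + m)%N -> sorted ltn s ->
    (forall x, x \in s -> M x) ->
    exists2 n : incr_tuple (l + m), n = s :> seq nat & incr_tuples_in M n.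
  move=> slm ss sM; have [n ns] := incr_tuple_of_seq slm ss.
  by exists n => // i; apply: sM; rewrite -ns mem_tnth.
apply: (@le_trans _ _ (iter_lim U w1 F)).
  apply: (iter_lim_closed (F := F) UU UM FB (@closed_ge _ _)) => s.
  rewrite size_block_word.
  move=> slm ss /(tupleM s slm ss)[n <- nM] /=.
  rewrite F1; apply: ge_inf; last by exists n.
  by exists 0 => _ [k _ <-]; exact: mdist_ge0.
have -> : iter_lim U w1 F =
    iter_lim U (block_word p) F.
  rewrite [LHS](iter_lim_shuffle stX UU nU _ bf' bg').
  rewrite [RHS](iter_lim_shuffle stX UU nU _ bf' bg').
  by rewrite !count_block_word_l !count_block_word_r.
rewrite mul1r.
apply: (iter_lim_closed (F := F) UU UM FB (@closed_le _ _)) => s.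
rewrite size_block_word.
move=> slm ss /(tupleM s slm ss)[n <- nM] /=.
rewrite Fp; apply: ub_le_sup; last by exists n.
by exists B' => _ [k _ <-]; exact: le_trans (ler_norm _) (fgB' _ _).
Qed.
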